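(* For any weak composition $a$ of length $n$, \[ \overline{\mathfrak{A}}_a^{(\beta)}=\sum_{T\in\overline{\mathfrak{A}}2\overline{\mathfrak{P}}(a)}\beta^{|T|-|a|}\,\overline{\mathfrak{P}}_{\mathrm{wt}(T)}^{(\beta)}, \] where $\overline{\mathfrak{A}}2\overline{\mathfrak{P}}(a)$ is the set of meson-highest semistandard set-valued skyline fillings of shape $a$. In particular, every Lascoux atom $\overline{\mathfrak{A}}_a$ is a positive sum of kaons.
   Context: Fix $n\ge1$; $\beta$ is a formal parameter. A weak composition of length $n$ is a sequence $a=(a_1,\dots,a_n)$ of nonnegative integers, $|a|=\sum_i a_i$, and $\mathbf{x}^a=x_1^{a_1}\cdots x_n^{a_n}$. Lascoux atoms. The skyline diagram $D(a)$ has $a_i$ left-justified boxes in row $i$; row $1$ is the lowest row. A triple consists of three boxes, two of them adjacent in a row (left box with entry $\beta'$, right box with entry $\alpha'$) and a third box with entry $\gamma'$, such that either (Type A) the third box is above the right box, in the same column as it, and the lower of the two rows is weakly longer, or (Type B) the third box is below the left box, in the same column as it, and the higher of the two rows is strictly longer. A triple is an inversion triple if $\gamma'<\alpha'\le\beta'$ or $\alpha'\le\beta'<\gamma'$. A set-valued filling assigns a nonempty set of positive integers to each box; the maximum of each box is its anchor, all other entries are free. It is semistandard if (S.1) entries do not repeat in a column; (S.2) rows are weakly decreasing from left to right, where $A\ge B$ means $\min A\ge\max B$; (S.3) every triple of anchors is an inversion triple; (S.4) each free entry is in the cell of the least anchor in its column such that (S.2) is not violated (i.e. among the cells of its column with larger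 anchor in which it could be placed without violating (S.2), it is in the one with least anchor); (S.5) anchors in the first column equal their row index. Let $\overline{\mathfrak{A}}\mathsf{SSF}(a)$ be the set of semistandard set-valued fillings of $D(a)$. For a filling $F$, $\mathrm{wt}(F)=(c_1,\dots,c_n)$ with $c_i$ the number of $i$'s in $F$, $|F|=|\mathrm{wt}(F)|$ is the total number of entries, and $\mathrm{ex}(F)=|F|-|a|$ is the number of free entries. The Lascoux atom is $\overline{\mathfrak{A}}_a^{(\beta)}=\sum_{F\in\overline{\mathfrak{A}}\mathsf{SSF}(a)}\beta^{\mathrm{ex}(F)}\mathbf{x}^{\mathrm{wt}(F)}$. Meson-highest. $T\in\overline{\mathfrak{A}}\mathsf{SSF}(a)$ is meson-highest if, for every integer $i$ appearing in $T$, either the leftmost $i$ is in the leftmost column and is an anchor, or there is an $i^\uparrow$ in some column weakly to the right of the leftmost $i$ and in a different box, where $i^\uparrow$ is the smallest label greater than $i$ appearing in $T$. Kaons. A weak komposition is a weak composition whose positive entries are each colored black or red (different colorings are different weak kompositions); its excess $\mathrm{ex}$ is the number of red entries. Let $a$ have nonzero entries exactly in positions $n_1<\dots<n_\ell$, and put $n_0=0$. A weak komposition $b$ of length $n$ is a mesonic glide of $a$ if $b_k=0$ for $k>n_\ell$ and, for each $1\le j\le\ell$: $a_{n_j}=b_{n_{j-1}+1}+\dots+b_{n_j}-\mathrm{ex}(b_{n_{j-1}+1},\dots,b_{n_j})$; the leftmost nonzero entry among $b_{n_{j-1}+1},\dots,b_{n_j}$ is black; and $b_{n_j}\ne0$.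 The kaon is $\overline{\mathfrak{P}}_a^{(\beta)}=\sum_b\beta^{\mathrm{ex}(b)}\mathbf{x}^b$ over all mesonic glides $b$ of $a$. *)

(* Defs.v *)
From mathcomp Require Import all_boot all_order all_algebra.
From mathcomp Require Export mpoly.

Set Implicit Arguments.
Unset Strict Implicit.
Unset Printing Implicit Defensive.

Import GRing.Theory.

Local Open Scope nat_scope.

(* Weak compositions of length n are the multinomials 'X_{1..n}.  Row indices,
   variable indices and filling entries all live in 'I_n, the positive integer
   i being represented by the ordinal of value i - 1; columns are likewise
   numbered from 0.  The formal parameter beta is 'X : {poly int}, so all
   generating functions are elements of {mpoly {poly int}[n]}. *)

Section Skyline.

Variables (n : nat) (a : 'X_{1..n}).

Definition box := {i : 'I_n & 'I_(a i)}.

Definition row (b : box) : 'I_n := tag b.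
Definition col (b : box) : nat := tagged b.

(* Entries are taken in {1, .., n}.  This loses no semistandard filling: by
   (S.5) the maximum of the first box of row i is i <= n, and by (S.2) it bounds
   every entry of the row. *)
Definition filling := {ffun box -> {set 'I_n}}.

Implicit Types F : filling.

Definition set_valued F := [forall b, F b != set0].

Definition anchor F (b : box) : nat := \max_(x in F b) x.

Definition column_distinct F :=
  [forall b, forall b', (col b == col b') && (b != b') ==> [disjoint F b & F b']].

Definition row_decreasing F :=
  [forall b, forall b', (row b == row b') && (col b' == (col b).+1) ==>
    [forall x in F b, forall y in F b', y <= x]].

(* l and r are the adjacent boxes of the triple and t is its third box. *)
Definition triple_A (l r t : box) :=
  [&& row l == row r, col r == (col l).+1, col t == col r, row l < row t
    & a (row t) <= a (row l)].

Definition triple_B (l r t : box) :=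
  [&& row l == row r, col r == (col l).+1, col t == col l, row t < row l
    & a (row t) < a (row l)].

Definition inversion_triple (beta' alpha' gamma' : nat) :=
  (gamma' < alpha' <= beta') || (alpha' <= beta' < gamma').

Definition anchor_triples F :=
  [forall l, forall r, forall t, triple_A l r t || triple_B l r t ==>
    inversion_triple (anchor F l) (anchor F r) (anchor F t)].

Definition free F (b : box) (x : 'I_n) := (x \in F b) && (x != anchor F b :> nat).

Definition move F (x : 'I_n) (b b' : box) : filling :=
  [ffun d => if d == b' then x |: F d else if d == b then F d :\ x else F d].

Definition free_least_anchor F :=
  [forall b, forall x, free F b x ==>
    [forall b', [&& col b' == col b, x < anchor F b'
                  & row_decreasing (move F x b b')] ==>
      (anchor F b <= anchor F b')]].

Definition first_column F :=
  [forall b, (col b == 0) ==> (anchor F b == row b)].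

Definition semistandard F :=
  [&& set_valued F, column_distinct F, row_decreasing F, anchor_triples F,
      free_least_anchor F & first_column F].

Definition wt F : 'X_{1..n} := [multinom #|[set b | i \in F b]| | i < n].

(* No truncation on semistandard fillings, whose boxes are all nonempty. *)
Definition ex F : nat := mdeg (wt F) - mdeg a.

Definition appears F (i : 'I_n) := [exists b, i \in F b].

Definition leftmost F (i : 'I_n) (b : box) :=
  (i \in F b) && [forall b', (i \in F b') ==> (col b <= col b')].

(* j is i^\uparrow; there is no such j when i is the largest label of F. *)
Definition next_label F (i j : 'I_n) :=
  [&& appears F j, i < j & [forall k, appears F k && (i < k) ==> (j <= k)]].

Definition meson_highest F :=
  [forall i, forall b, leftmost F i b ==>
    ((col b == 0) && (anchor F b == i))
    || [exists j, next_label F i j &&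
         [exists b', [&& j \in F b', col b <= col b' & b' != b]]]].

Definition lascoux_atom : {mpoly {poly int}[n]} :=
  (\sum_(F : filling | semistandard F) ('X ^+ ex F : {poly int}) *: 'X_[wt F])%R.

End Skyline.

Section Kaon.

Variables (n : nat).

(* A weak komposition is a pair (b, red): a weak composition b together with
   the set of positions of its red entries. *)
Definition komposition (b : 'X_{1..n}) (red : {set 'I_n}) :=
  [forall k in red, b k != 0].

(* For a p != 0, i.e. p = n_j, this is the interval n_{j-1} < k <= n_j. *)
Definition block (a : 'X_{1..n}) (p : 'I_n) : {set 'I_n} :=
  [set k : 'I_n | (k <= p) && [forall q : 'I_n, (a q != 0) && (q < p) ==> (q < k)]].

Definition mesonic_glide (a b : 'X_{1..n}) (red : {set 'I_n}) :=
  [&& komposition b red,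
      [forall k : 'I_n, [forall q : 'I_n, (a q != 0) ==> (q < k)] ==> (b k == 0)]
    & [forall p, (a p != 0) ==>
        [&& (* a_{n_j} = sum - ex, without truncated subtraction *)
            a p + #|block a p :&: red| == \sum_(k in block a p) b k,
            [forall k in block a p,
              (b k != 0) && [forall k' in block a p, (k' < k) ==> (b k' == 0)]
                ==> (k \notin red)]
          & b p != 0]]].

Lemma mesonic_glide_mdeg (a b : 'X_{1..n}) (red : {set 'I_n}) :
  mesonic_glide a b red -> mdeg b <= mdeg a + n.
Proof.
case/and3P=> _ /forallP gt0 /forallP glide.
have lower (p q k : 'I_n) : a q != 0 -> q < p -> k \in block a p -> q < k.
  by move=> aq qp; rewrite inE => /andP[_ /forallP /(_ q)]; rewrite aq qp.
have cover (k : 'I_n) : b k != 0 -> exists2 p, a p != 0 & k \in block a p.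
  move=> bk; have /existsP[p0 p0P] : [exists p : 'I_n, (a p != 0) && (k <= p)].
    apply: contraR bk => /existsPn none; have /implyP := gt0 k; apply.
    apply/forallP => q; apply/implyP => aq.
    by have := none q; rewrite aq /= -ltnNge.
  case: (@arg_minnP _ p0 (fun p : 'I_n => (a p != 0) && (k <= p)) val p0P) => p /andP[ap kp] pmin.
  exists p => //; rewrite inE kp; apply/forallP => q; apply/implyP => /andP[aq qp].
  by rewrite ltnNge; apply: contraTN qp => kq; rewrite -leqNgt; apply: pmin; rewrite aq kq.
have uniqb (k p q : 'I_n) : a p != 0 -> a q != 0 -> k \in block a p -> k \in block a q ->
    p = q.
  move=> ap aq kp kq; apply: val_inj; case: (ltngtP p q) => // pq.
    have := lower _ _ _ ap pq kq; rewrite ltnNge.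
    by move: kp; rewrite inE => /andP[->].
  have := lower _ _ _ aq pq kp; rewrite ltnNge.
  by move: kq; rewrite inE => /andP[->].
have le1 : mdeg b <= \sum_(p | a p != 0) \sum_(k in block a p) b k.
  rewrite mdegE (exchange_big_dep xpredT) //=; apply: leq_sum => k _.
  have [-> //|bk] := eqVneq (b k) 0; have [p ap kp] := cover k bk.
  by rewrite (bigD1 p) ?ap //= leq_addr.
apply: (leq_trans le1).
have -> : \sum_(p | a p != 0) \sum_(k in block a p) b k
        = \sum_(p | a p != 0) (a p + #|block a p :&: red|).
  by apply: eq_bigr => p ap; have /implyP/(_ ap)/and3P[/eqP-> _ _] := glide p.
rewrite big_split /=; apply: leq_add.
  by rewrite mdegE [leqRHS](bigID (fun p => a p != 0)) /= leq_addr.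
have -> : \sum_(p | a p != 0) #|block a p :&: red|
        = \sum_(p | a p != 0) \sum_(k in block a p :&: red) 1.
  by apply: eq_bigr => p _; rewrite sum1_card.
rewrite (exchange_big_dep xpredT) //= -[leqRHS]card_ord -sum1_card.
apply: leq_sum => k _.
case: (pickP (fun p => (a p != 0) && (k \in block a p :&: red))) => [p | none].
  case/andP=> ap kp; rewrite (bigD1 p) ?ap //= big1 // => q.
  case/andP=> /andP[aq kq] /eqP[]; move: kp kq; rewrite !inE -!andbA.
  case/and3P=> kp fp _ /and3P[kq fq _].
  by apply: (uniqb k) => //; rewrite inE ?kp ?kq.
by rewrite big_pred0.
Qed.

(* By mesonic_glide_mdeg, this degree bound excludes no mesonic glide. *)
Definition kaon (a : 'X_{1..n}) : {mpoly {poly int}[n]} :=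
  (\sum_(b : 'X_{1..n < (mdeg a + n).+1})
     \sum_(red : {set 'I_n} | mesonic_glide a b red)
       ('X ^+ #|red| : {poly int}) *: 'X_[b])%R.

End Kaon.

(* Main.v *)
Require Import Defs.
From mathcomp Require Import all_boot all_order all_algebra.
From mathcomp Require Import mpoly.
Import GRing.Theory Defs.

Set Implicit Arguments.
Unset Strict Implicit.
Unset Printing Implicit Defensive.

(** Call a label of a filling good if it satisfies the condition in the
    definition of meson-highest. Replacing every label by the least good label
    above it yields a meson-highest filling: in a block of labels below a good
    label p, each label stands weakly to the left of all smaller ones (in the
    same column only if in the same box), so the replacement preserves every
    comparison that the semistandard conditions depend on.

    Conversely, the labels of a block, read from left to right, cut the
    occurrences of p into consecutive intervals in decreasing order of labels,
    two neighbouring intervals overlapping in at most one box. The lengths of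
    these intervals, with the larger label of an overlap marked red, form a
    mesonic glide of the weight of the meson-highest filling, and every mesonic
    glide arises from exactly one filling. The fibre over a meson-highest T thus
    contributes the kaon of wt(T). *)

(** * Rounding a label up to a given set of labels *)

Section Rounding.

Local Open Scope nat_scope.

Variable n : nat.
Implicit Types (S : {set 'I_n}) (i k p : 'I_n).

(* Unlike in [arg_minnP], the default value need not satisfy the predicate. *)
Lemma arg_min_default (P : pred 'I_n) k p :
  P p -> let m := [arg min_(q < k | P q) q] in P m /\ forall q, P q -> m <= q.
Proof.
move=> Pp; rewrite /arg_min /extremum; case: pickP => /= [m /andP[Pm /forallP mmin]| none].
  by split=> // q Pq; apply: (implyP (mmin q)).
case: (@arg_minnP _ p P val Pp) => m Pm mmin; case/andP: (none m); split=> //.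
by apply/forallP => q; apply/implyP => /mmin.
Qed.

(* Junk value: up S k = k when no element of S is at least k. *)
Definition up S k : 'I_n := [arg min_(p < k | (p \in S) && (k <= p)) p].

Lemma up_min S k p : p \in S -> k <= p -> [/\ up S k \in S, k <= up S k & up S k <= p].
Proof.
move=> pS kp; have Pp : (p \in S) && (k <= p) by rewrite pS.
by have [/andP[? ?] up_le] := @arg_min_default (fun p => (p \in S) && (k <= p)) k _ Pp;
  split=> //; apply: up_le.
Qed.

Lemma up_id S p : p \in S -> up S p = p.
Proof. by move=> pS; case: (up_min pS (leqnn p)) => _ h1 h2; apply/val_inj/anti_leq/andP. Qed.

Lemma leq_up S k : k <= up S k.
Proof.
rewrite /up /Order.arg_min /arg_min /extremum.
by case: pickP => [q /andP[/andP[_ ->]]|].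
Qed.

Lemma up_leq S i k : i <= k -> up S k \in S -> up S i <= up S k.
Proof. by move=> ik kS; case: (up_min kS (leq_trans ik (leq_up S k))). Qed.

Lemma up_ltn S i k : up S i \in S -> up S i < up S k -> i < k.
Proof. by move=> iS; rewrite !ltnNge; apply: contra => ki; apply: up_leq. Qed.

End Rounding.

(** * Relabelling a filling by rounding its labels up *)

Section Relabelling.

Local Open Scope nat_scope.

Variables (n : nat) (a : 'X_{1..n}).
Implicit Types (T : filling a) (S : {set 'I_n}) (B b l r t : box a) (i j k p x y : 'I_n).

Definition labels T := [set i | appears T i].

Definition meson_label T i :=
  [forall b, leftmost T i b ==>
    ((col b == 0) && (anchor T b == i))
    || [exists j, next_label T i j &&
         [exists b', [&& j \in T b', col b <= col b' & b' != b]]]].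

(** The good labels. A label that does not appear satisfies [meson_label] vacuously, hence the first
    conjunct. *)
Definition highs T := [set i | appears T i && meson_label T i].

Definition relabel S T : filling a := [ffun b => up S @: T b].

Definition before b' b := (col b' < col b) || (b' == b).

(** The condition shared by both directions of the bijection: it holds for [S = highs T] with [T]
    semistandard, and for fillings built from mesonic glides. Different labels of a block may share
    a box, but may not occupy distinct boxes of one column. *)
Definition chained S T :=
  [/\ forall b x, x \in T b -> up S x \in S,
      S \subset labels T
    & forall b b' x y, x \in T b -> y \in T b' -> up S x = up S y -> x < y ->
        before b' b].

Lemma labelsP T x : reflect (exists b, x \in T b) (x \in labels T).
Proof. by rewrite inE; apply: existsP. Qed.

Lemma mem_labels T b x : x \in T b -> x \in labels T.
Proof. by move=> xb; apply/labelsP; exists b. Qed.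

Lemma meson_highestE T : meson_highest T = (highs T == labels T).
Proof.
apply/idP/eqP => [/forallP mh | eqL].
  by apply/setP => i; rewrite !inE; case: (appears T i) => //=; apply: mh.
apply/forallP => i; apply/forallP => b; apply/implyP => lb.
have: i \in labels T by case/andP: lb => /mem_labels.
by rewrite -eqL inE => /andP[_ /forallP /(_ b)]; rewrite lb.
Qed.

Lemma before_trans b1 b2 b3 : before b1 b2 -> before b2 b3 -> before b1 b3.
Proof.
rewrite /before; case/orP=> [h12 | /eqP-> //].
by case/orP=> [h23 | /eqP<-]; rewrite ?h12 // (ltn_trans h12).
Qed.

Lemma before_col b1 b2 : before b1 b2 -> col b1 <= col b2.
Proof. by case/orP=> [/ltnW // | /eqP->]. Qed.

Lemma before_anti b1 b2 : before b1 b2 -> before b2 b1 -> b1 = b2.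
Proof.
by case/orP=> [h | /eqP //] /orP[h' | /eqP //]; move: (ltn_trans h h'); rewrite ltnn.
Qed.

Lemma before0 b1 b2 : before b1 b2 -> col b2 = 0 -> b1 = b2.
Proof. by case/orP=> [h e | /eqP //]; rewrite e in h. Qed.

Lemma column_distinctP T :
  reflect (forall b b' x, col b = col b' -> x \in T b -> x \in T b' -> b = b')
          (column_distinct T).
Proof.
apply: (iffP forallP) => [cd b b' x cb xb xb' | cd b].
  apply/eqP; apply: contraT => nb; have /forallP/(_ b') := cd b.
  rewrite cb eqxx nb /= => /pred0P /(_ x) /=; by rewrite xb xb'.
apply/forallP => b'; apply/implyP => /andP[/eqP cb nb].
apply/pred0P => x /=; apply/negP => /andP[xb xb'].
by rewrite (cd b b' x) ?eqxx in nb.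
Qed.

Lemma row_decreasingP T :
  reflect (forall b b' x y, row b = row b' -> col b' = (col b).+1 ->
             x \in T b -> y \in T b' -> y <= x)
          (row_decreasing T).
Proof.
apply: (iffP forallP) => [rd b b' x y rb cb xb yb' | rd b].
  have /forallP/(_ b') := rd b; rewrite rb cb !eqxx /=.
  by move=> /forall_inP/(_ x xb)/forall_inP/(_ y yb').
apply/forallP => b'; apply/implyP => /andP[/eqP rb /eqP cb].
by apply/forall_inP => x xb; apply/forall_inP => y yb'; apply: (rd b b').
Qed.

Lemma leq_anchor T b x : x \in T b -> x <= anchor T b.
Proof. by move=> xb; apply: (@leq_bigmax_cond _ _ (fun i : 'I_n => val i)). Qed.

Lemma anchor_mem T b : set_valued T -> exists2 x, x \in T b & anchor T b = x.
Proof.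
move=> /forallP/(_ b); rewrite -card_gt0 => sv.
by have [x xb ax] := eq_bigmax_cond (fun i : 'I_n => val i) sv; exists x.
Qed.

(** Condition (S.2) for a hypothetical entry [x] of [b], stated without [move], which does not
    commute with relabelling when a box holds two labels of one block. *)
Definition fits T x b :=
  (forall l y, row l = row b -> col b = (col l).+1 -> y \in T l -> x <= y) /\
  (forall r y, row b = row r -> col r = (col b).+1 -> y \in T r -> y <= x).

(** The move leaves the neighbouring columns untouched, and taking [x] out of [b] only relaxes
    (S.2). *)
Lemma row_decreasing_moveP T x b b' :
  row_decreasing T -> col b' = col b -> b' != b ->
  reflect (fits T x b') (row_decreasing (move T x b b')).
Proof.
move=> /row_decreasingP rd cb nb.
have moveE z d : z \in move T x b b' d ->
    z \in T d \/ (z = x /\ d = b').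
  rewrite ffunE; case: eqP => [->|_]; first by case/setU1P=> [->|]; [right|left].
  by case: eqP => [_|_]; [case/setD1P|]; left.
have moveN z d : col d != col b -> z \in T d -> z \in move T x b b' d.
  move=> nd zd; rewrite ffunE; case: (d =P b') => [e|_].
    by rewrite e cb eqxx in nd.
  by case: (d =P b) nd => [->|//]; rewrite eqxx.
have xm : x \in move T x b b' b' by rewrite ffunE eqxx setU11.
apply: (iffP (row_decreasingP _)) => [rd' | [fl fr] d d' u v rw cl].
  split=> [l y rw cl yl | r y rw cl yr].
    by apply: (rd' l b') => //; apply: moveN => //; rewrite -cb cl ltn_eqF.
  by apply: (rd' b' r) => //; apply: moveN => //; rewrite -cb cl gtn_eqF.
case/moveE=> [ud | [-> db]] /moveE[vd' | [-> db']].
- exact: (rd d d').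
- by apply: (fl d) => //; rewrite -db'.
- by apply: (fr d') => //; rewrite -db.
- by rewrite leqnn.
Qed.

Lemma free_least_anchorP T :
  row_decreasing T ->
  reflect (forall b b' x, b' != b -> col b' = col b -> x \in T b ->
             x < anchor T b -> x < anchor T b' -> fits T x b' ->
             anchor T b <= anchor T b')
          (free_least_anchor T).
Proof.
move=> rd; apply: (iffP forallP) => [fa b b' x nb cb xb xa xa' xf | fa b].
  have /forallP/(_ x) := fa b; rewrite /free xb (ltn_eqF xa) /=.
  move=> /forallP/(_ b') /implyP; apply.
  by rewrite cb eqxx xa' /=; apply/row_decreasing_moveP.
apply/forallP => x; apply/implyP => /andP[xb xa]; apply/forallP => b'.
apply/implyP => /and3P[/eqP cb xa' rm].
have [-> //|nb] := eqVneq b' b.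
apply: (fa b b' x) => //; last by apply/(row_decreasing_moveP _ rd): rm.
by rewrite ltn_neqAle xa leq_anchor.
Qed.

(** * Invariance of the semistandard conditions under relabelling *)

Section Chained.

Variables (S : {set 'I_n}) (T : filling a).
Hypothesis chT : chained S T.

Let chS b x : x \in T b -> up S x \in S.
Proof. by case: chT => h _ _; apply: h. Qed.

Let chL p : p \in S -> exists b, p \in T b.
Proof. by case: chT => _ h _ pS; apply/labelsP/(subsetP h). Qed.

Let chB b b' x y :
  x \in T b -> y \in T b' -> up S x = up S y -> x < y -> before b' b.
Proof. by case: chT => _ _; apply. Qed.

Lemma relabelP b p :
  reflect (exists2 x, x \in T b & p = up S x) (p \in relabel S T b).
Proof. by rewrite ffunE; apply: imsetP. Qed.

Lemma mem_relabel b x : x \in T b -> up S x \in relabel S T b.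
Proof. by move=> xb; apply/relabelP; exists x. Qed.

Lemma labels_relabel : labels (relabel S T) = S.
Proof.
apply/setP => p; apply/labelsP/idP => [[b /relabelP[x xb ->]] | pS]; first exact: chS xb.
by have [b pb] := chL pS; exists b; rewrite -(up_id pS); apply: mem_relabel.
Qed.

Lemma set_valued_relabel : set_valued (relabel S T) = set_valued T.
Proof. by apply: eq_forallb => b; rewrite ffunE imset_eq0. Qed.

Lemma anchor_relabel b x :
  x \in T b -> anchor T b = x -> anchor (relabel S T) b = up S x.
Proof.
move=> xb ax; apply/anti_leq/andP; split; last exact/leq_anchor/mem_relabel.
apply/bigmax_leqP => p /relabelP[y yb ->]; apply: up_leq; last exact: chS xb.
by rewrite -ax leq_anchor.
Qed.

(** Rounding could only break the equivalence by merging some [x < y]; chaining would then put [b']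
    before [b], against the column order. *)
Lemma up_leq_left b b' x y :
  x \in T b -> y \in T b' -> col b < col b' -> (up S y <= up S x) = (y <= x).
Proof.
move=> xb yb' cb; apply/idP/idP => [| yx]; last by apply: up_leq (chS xb).
rewrite leq_eqVlt => /orP[/eqP/val_inj e | ]; last first.
  by move/up_ltn=> /(_ (chS yb')) /ltnW.
rewrite leqNgt; apply/negP => xy; have := before_col (chB xb yb' (esym e) xy).
by rewrite leqNgt cb.
Qed.

(** Inside a column [before] is equality, so different labels of a block that meet there share their
    box; for equal labels this is (S.1). *)
Lemma up_column_inj b b' x y :
  column_distinct T -> x \in T b -> y \in T b' -> col b = col b' ->
  up S x = up S y -> b = b'.
Proof.
move=> /column_distinctP cd xb yb' cb e.
case: (ltngtP x y) => [xy | yx | /val_inj xy]; last by apply: (cd _ _ x); rewrite // xy.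
  by have := chB xb yb' e xy; rewrite /before cb ltnn => /eqP.
by have := chB yb' xb (esym e) yx; rewrite /before cb ltnn => /eqP.
Qed.

Lemma up_ltn_column b b' x y :
  column_distinct T -> x \in T b -> y \in T b' -> col b = col b' -> b != b' ->
  (up S x < up S y) = (x < y).
Proof.
move=> cd xb yb' cb nb; apply/idP/idP => [/up_ltn-> // | xy]; first exact: chS xb.
rewrite ltn_neqAle up_leq ?(ltnW xy) ?andbT //; last exact: chS yb'.
by apply: contraNneq nb => /val_inj /(up_column_inj cd xb yb' cb) ->.
Qed.

Lemma column_distinct_relabel : column_distinct (relabel S T) = column_distinct T.
Proof.
apply/idP/idP => cd; apply/column_distinctP => b b' p cb.
  move=> pb pb'; apply: (column_distinctP _ cd _ _ (up S p)) => //; exact: mem_relabel.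
case/relabelP=> x xb -> /relabelP[y yb' e]; exact: (up_column_inj cd xb yb').
Qed.

Lemma row_decreasing_relabel : row_decreasing (relabel S T) = row_decreasing T.
Proof.
apply/row_decreasingP/row_decreasingP => rd b b' x y rw cl.
  move=> xb yb'; rewrite -(up_leq_left xb yb') ?cl //.
  by apply: (rd b b') => //; apply: mem_relabel.
case/relabelP=> u ub -> /relabelP[v vb' ->].
by rewrite (up_leq_left ub vb') ?cl //; apply: (rd b b').
Qed.

Lemma fits_relabel b b' x :
  x \in T b -> col b = col b' -> fits (relabel S T) (up S x) b' <-> fits T x b'.
Proof.
move=> xb cb; split=> [[fl fr] | [fl fr]]; split=> c y rw cl.
- by move=> yc; rewrite -(up_leq_left yc xb) ?cb ?cl //; apply/(fl c)/mem_relabel.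
- by move=> yc; rewrite -(up_leq_left xb yc) ?cb ?cl //; apply/(fr c)/mem_relabel.
- case/relabelP=> z zc ->; rewrite (up_leq_left zc xb) ?cb ?cl //; exact: (fl c).
- case/relabelP=> z zc ->; rewrite (up_leq_left xb zc) ?cb ?cl //; exact: (fr c).
Qed.

(** Of the three comparisons involved, two are between different columns and fall under
    [up_leq_left]. The third compares [t] with the box in its own column, [r] in type A and [l] in
    type B, and falls under [up_ltn_column]. *)
Lemma inversion_triple_relabel l r t :
  set_valued T -> column_distinct T -> triple_A l r t || triple_B l r t ->
  inversion_triple (anchor (relabel S T) l) (anchor (relabel S T) r) (anchor (relabel S T) t)
  = inversion_triple (anchor T l) (anchor T r) (anchor T t).
Proof.
move=> sv cd tr.
have [be bel ael] := anchor_mem l sv; have [al alr aer] := anchor_mem r sv.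
have [ga gat aet] := anchor_mem t sv.
rewrite (anchor_relabel bel ael) (anchor_relabel alr aer) (anchor_relabel gat aet).
rewrite ael aer aet /inversion_triple.
have clr : col l < col r.
  by case/orP: tr => /and5P[_ /eqP-> _ _ _].
rewrite (up_leq_left bel alr clr).
case/orP: tr => /and5P[rlr _ /eqP ct rt _].
  have nt : t != r by apply: contraTneq rt => ->; rewrite (eqP rlr) ltnn.
  rewrite (up_ltn_column cd gat alr) //; congr (_ || (_ && _)).
  by rewrite ltnNge (up_leq_left bel gat) -?ltnNge // ct.
have nt : l != t by apply: contraTneq rt => ->; rewrite ltnn.
rewrite (up_ltn_column cd bel gat) //; congr ((_ && _) || _).
by rewrite ltnNge (up_leq_left gat alr) -?ltnNge // ct.
Qed.

Lemma anchor_triples_relabel :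
  set_valued T -> column_distinct T -> anchor_triples (relabel S T) = anchor_triples T.
Proof.
move=> sv cd; apply: eq_forallb => l; apply: eq_forallb => r; apply: eq_forallb => t.
have [tr|//] := boolP (triple_A l r t || triple_B l r t).
by rewrite inversion_triple_relabel.
Qed.

Lemma free_least_anchor_relabel :
  set_valued T -> column_distinct T -> row_decreasing T ->
  free_least_anchor (relabel S T) = free_least_anchor T.
Proof.
move=> sv cd rd; have rd' := rd; rewrite -row_decreasing_relabel in rd'.
apply/(free_least_anchorP rd')/(free_least_anchorP rd) => fa b b' x nb cb;
  have [al alb ae] := anchor_mem b sv; have [al' alb' ae'] := anchor_mem b' sv;
  move: (fa b b'); rewrite (anchor_relabel alb ae) (anchor_relabel alb' ae') ae ae' nb cb.
  move=> {}fa xb xa xa' xf.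
  have upx : up S x < up S al' by rewrite (up_ltn_column cd xb alb') // eq_sym.
  rewrite leqNgt -(up_ltn_column cd alb' alb) // -leqNgt.
  have: up S x <= up S al by apply: up_leq (ltnW xa) (chS alb).
  (* If [x] merges with the anchor of its box it is no longer free, but then [upx] already compares
     the two anchors. *)
  rewrite leq_eqVlt => /orP[/eqP <- | xal]; first exact: ltnW.
  apply: (fa (up S x)) => //; first exact: mem_relabel.
  by apply/(fits_relabel xb).
move=> {}fa /relabelP[z zb ->] za za' zf.
have {}za := up_ltn (chS zb) za; have {}za' := up_ltn (chS zb) za'.
apply: up_leq (chS alb'); apply: (fa z) => //.
by apply/(fits_relabel zb).
Qed.

(** If the anchor were rounded up to a larger [p], chaining would put every occurrence of [p] before
    [b], hence in [b] itself, where nothing exceeds the anchor. *)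
Lemma anchor_column0 b :
  set_valued T -> col b = 0 -> anchor (relabel S T) b = anchor T b.
Proof.
move=> sv c0; have [x xb ax] := anchor_mem b sv.
rewrite (anchor_relabel xb ax) ax; apply/eqP; rewrite eqn_leq leq_up andbT leqNgt.
apply/negP => xp; have pS := chS xb; have [b' pb'] := chL pS.
have e : b' = b by apply: (before0 _ c0); apply: (chB xb pb') => //; rewrite (up_id pS).
by rewrite e in pb'; have := leq_anchor pb'; rewrite ax leqNgt xp.
Qed.

Lemma first_column_relabel :
  set_valued T -> first_column (relabel S T) = first_column T.
Proof.
move=> sv; apply: eq_forallb => b; have [c0|//] := eqVneq (col b) 0.
by rewrite anchor_column0.
Qed.

Lemma semistandard_relabel : semistandard (relabel S T) = semistandard T.
Proof.
rewrite /semistandard set_valued_relabel column_distinct_relabel row_decreasing_relabel.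
have [sv|//] := boolP (set_valued T); have [cd|//] := boolP (column_distinct T).
have [rd|//] := boolP (row_decreasing T).
by rewrite anchor_triples_relabel // free_least_anchor_relabel // first_column_relabel.
Qed.

(** The new copies of [k] come from smaller labels of its block, and every original occurrence of
    [k] is before them. *)
Lemma leftmost_relabel k b : k \in S -> leftmost (relabel S T) k b = leftmost T k b.
Proof.
move=> kS; have relk b' x : x \in T b' -> k = up S x -> x < k ->
    forall c, k \in T c -> before c b'.
  by move=> xb' e xk c kc; apply: (chB xb' kc) => //; rewrite -e (up_id kS).
have memk c : k \in T c -> k \in relabel S T c.
  by move=> kc; rewrite -{1}(up_id kS); apply: mem_relabel.
apply/andP/andP => [[kb /forallP lk] | [kb /forallP lk]]; split.
- case/relabelP: kb => x xb e; have := leq_up S x; rewrite -e leq_eqVlt.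
  case/orP=> [/eqP/val_inj <- // | xk]; have [c kc] := chL kS.
  have := relk _ _ xb e xk c kc; rewrite /before; case/orP=> [lt | /eqP<- //].
  by have := lk c; rewrite memk //= leqNgt lt.
- by apply/forallP => c; apply/implyP => kc; have := lk c; rewrite memk.
- exact: memk.
apply/forallP => c; apply/implyP => /relabelP[x xc e].
have := leq_up S x; rewrite -e leq_eqVlt => /orP[/eqP/val_inj xk | xk].
  by have := lk c; rewrite -xk xc.
have [d kd] := chL kS; have := before_col (relk _ _ xc e xk d kd).
by apply: leq_trans; have := lk d; rewrite kd.
Qed.

End Chained.


Lemma next_label_leq T k p :
  p \in labels T -> k < p -> exists2 j, next_label T k j & j <= p.
Proof.
move=> pL kp; have Pp : (p \in labels T) && (k < p) by rewrite pL.
case: (@arg_minnP _ p (fun q : 'I_n => (q \in labels T) && (k < q)) val Pp).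
move=> j /andP[jL kj] jmin; exists j; last exact: jmin.
move: jL; rewrite inE => aj; rewrite /next_label aj kj; apply/forallP => q.
by apply/implyP => /andP[aq kq]; apply: jmin; rewrite inE aq.
Qed.

Lemma next_labelP T k j :
  next_label T k j ->
  [/\ j \in labels T, k < j & forall q, q \in labels T -> k < q -> j <= q].
Proof.
case/and3P=> aj kj /forallP jm; split=> // [|q]; first by rewrite inE.
by rewrite inE => aq kq; have := jm q; rewrite aq kq.
Qed.

(** * Invariance of the meson condition under relabelling *)

Section ChainedMeson.

Variables (S : {set 'I_n}) (T : filling a).
Hypothesis chT : chained S T.

Let chS b x : x \in T b -> up S x \in S.
Proof. by case: chT => h _ _; apply: h. Qed.

Let chL p : p \in S -> p \in labels T.
Proof. by case: chT => _ h _ pS; apply: (subsetP h). Qed.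

Let chB b b' x y :
  x \in T b -> y \in T b' -> up S x = up S y -> x < y -> before b' b.
Proof. by case: chT => _ _; apply. Qed.

(** The next label of [k] after relabelling is the rounding of its next label [i] in [T]. Where a
    copy of it comes from a larger label of the block of [i], that copy is before every [i], so [i]
    itself is a witness weakly further right. *)
Lemma meson_label_relabel k :
  set_valued T -> k \in S -> meson_label (relabel S T) k = meson_label T k.
Proof.
move=> sv kS; apply: eq_forallb => b; rewrite (leftmost_relabel chT b kS).
case: leftmost => //=.
congr (_ || _); first by have [c0|//] := eqVneq (col b) 0; rewrite (anchor_column0 chT).
apply/existsP/existsP => -[j /andP[/next_labelP[]]].
  rewrite (labels_relabel chT) => jS kj jmin /existsP[b' /and3P[]].
  case/relabelP=> x xb' ej cb nb.
  have kx : k < x.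
    rewrite ltnNge; apply/negP => xk; have := @up_leq _ S _ _ xk.
    by rewrite (up_id kS) -ej leqNgt kj => /(_ kS).
  have [i ni ix] := next_label_leq (mem_labels xb') kx.
  exists i; rewrite ni /=; have [/labelsP[c ic] ki imin] := next_labelP ni.
  have [e|nix] := eqVneq i x; first by apply/existsP; exists b'; rewrite e xb' cb.
  have upi : up S i = up S x.
    apply/val_inj/anti_leq; rewrite up_leq ?(chS xb') //= -ej.
    by apply: jmin; [exact: chS ic | exact: leq_trans (leq_up _ _)].
  have bc : before b' c by apply: (chB ic xb') => //; rewrite ltn_neqAle nix.
  apply/existsP; exists c; rewrite ic /= (leq_trans cb (before_col bc)) /=.
  case/orP: bc => [lt | /eqP <- //].
  by apply: contraTneq lt => ->; rewrite -leqNgt.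
move=> /labelsP[c jc] kj jmin /existsP[b' /and3P[jb' cb nb]].
have uS := chS jc.
exists (up S j); apply/andP; split; last first.
  by apply/existsP; exists b'; rewrite cb nb mem_relabel.
apply/and3P; split.
- have: up S j \in labels (relabel S T) by rewrite (labels_relabel chT).
  by rewrite inE.
- exact: leq_trans (leq_up _ _).
apply/forallP => q; apply/implyP => /andP[aq kq].
have qS : q \in S by rewrite -(labels_relabel chT) inE.
by case: (up_min qS (jmin q (chL qS) kq)).
Qed.

(** The next label of [k] lies in the same block, so its occurrences are all before those of [k]. In
    the first column [k] cannot be an anchor, since [up S k] would be in its box. *)
Lemma meson_label_notin k : k \in labels T -> k \notin S -> ~~ meson_label T k.
Proof.
move=> /labelsP[b0 kb0] kS; have pS := chS kb0.
have kp : k < up S k.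
  by rewrite ltn_neqAle leq_up andbT; apply: contraNneq kS => /val_inj ->.
have [j nj jp] := next_label_leq (chL pS) kp.
have [b kb bmin] := @arg_minnP _ b0 (fun b => k \in T b) (@col n a) kb0.
apply/negP => /forallP/(_ b); rewrite /leftmost kb /=.
have -> /= : [forall b', (k \in T b') ==> (col b <= col b')].
  by apply/forallP => b'; apply/implyP => /bmin.
case/orP=> [/andP[/eqP c0 /eqP ab] | /existsP[i /andP[ni /existsP[c]]]].
  have [c pc] := labelsP _ _ (chL pS).
  have e : c = b by apply: (before0 _ c0); apply: (chB kb pc) => //; rewrite (up_id pS).
  by rewrite e in pc; have := leq_anchor pc; rewrite ab leqNgt kp.
have [iL ki imin] := next_labelP ni.
have ip : i <= up S k by apply: imin => //; apply: chL.
case/and3P=> ic cb nc.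
have e : up S k = up S i.
  apply/val_inj/anti_leq/andP; split; first exact: up_leq (ltnW ki) (chS ic).
  by case: (up_min pS ip).
have := chB kb ic e ki; rewrite /before (negPf nc) orbF.
by rewrite ltnNge cb.
Qed.

Lemma highs_relabel : set_valued T -> highs (relabel S T) = highs T.
Proof.
move=> sv; apply/setP => k; have [kS | kS] := boolP (k \in S).
  have kL := chL kS; have kL' : k \in labels (relabel S T) by rewrite (labels_relabel chT).
  by move: kL kL'; rewrite !inE => -> ->; rewrite meson_label_relabel.
transitivity false; last first.
  apply/esym/negbTE; rewrite inE negb_and; case: (boolP (appears T k)) => //= ak.
  by apply: meson_label_notin; rewrite ?inE.
have: k \notin labels (relabel S T) by rewrite (labels_relabel chT).
by rewrite !inE => /negPf ->.
Qed.

(** Among the sets [S] that chain [T], only [highs T] can yield a meson-highest filling; this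
    determines the fibres. *)
Lemma meson_highest_relabel :
  set_valued T -> meson_highest (relabel S T) = (highs T == S).
Proof. by move=> sv; rewrite meson_highestE highs_relabel // labels_relabel. Qed.

End ChainedMeson.

(** * Semistandard fillings are chained over their good labels *)

Lemma row_first_box T b :
  set_valued T -> row_decreasing T ->
  exists b0, col b0 = 0 /\ forall y, y \in T b -> y <= anchor T b0.
Proof.
move=> sv /row_decreasingP rd; have [c] := ubnP (col b); elim: c => // c IH in b *.
case: b => i [[|k] lk] /= kc; first by exists (Tagged (fun i => 'I_(a i)) (Ordinal lk)); split=> // y /leq_anchor.
pose b' : box a := Tagged (fun i => 'I_(a i)) (Ordinal (ltnW lk)).
have [//|b0 [c0 b0max]] := IH b'.
exists b0; split=> // y yb; have [z zb' _] := anchor_mem b' sv.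
by apply: leq_trans (b0max z zb'); apply: (rd b' _ z y _ _ zb' yb).
Qed.

(** The largest label of [T] is good: by (S.2) it is the anchor of the first box of its row, and by
    (S.1) that box is its only leftmost one. *)
Lemma highs_above T b x :
  semistandard T -> x \in T b -> exists2 m, m \in highs T & x <= m.
Proof.
case/and5P=> sv cd rd _ /andP[_ fc] xb.
have [m mL mmax] := @arg_maxnP _ x (fun m => m \in labels T) val (mem_labels xb).
exists m; last exact: mmax (mem_labels xb).
have [c mc] := labelsP _ _ mL; have [b0 [c0 b0max]] := row_first_box c sv rd.
have [y yb0 ay] := anchor_mem b0 sv.
have my : m = y.
  apply/val_inj/anti_leq/andP; split; last exact: mmax (mem_labels yb0).
  by have := b0max m mc; rewrite ay.
have am : appears T m by rewrite inE in mL.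
rewrite inE am; apply/forallP => d; apply/implyP => /andP[md /forallP/(_ b0)].
rewrite my yb0 c0 leqn0 => /= d0.
have -> : d = b0.
  by apply: (column_distinctP _ cd _ _ y) => //; [rewrite c0; apply/eqP | rewrite -my].
by rewrite c0 ay !eqxx.
Qed.

(** If [x] is not good, every occurrence of its next label is before the leftmost [x]. Iterating
    this along the labels from [x] up to [y], none of which is good before [y], gives the claim by
    induction on [y - x]. *)
Lemma chained_highs T : semistandard T -> chained (highs T) T.
Proof.
move=> ss; have [sv cd rd _ _] := and5P ss.
have upS b x : x \in T b -> up (highs T) x \in highs T.
  by move=> xb; have [m mS xm] := highs_above ss xb; case: (up_min mS xm).
split=> //; first by apply/subsetP => x; rewrite !inE => /andP[].
move=> b b' x y; have [k] := ubnP (y - x); elim: k => // k IH in x b *.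
move=> yxk xb yb' e xy.
have xS : x \notin highs T.
  by apply: contraTN xy => xS; rewrite -leqNgt -(up_id xS) e leq_up.
have : ~~ meson_label T x.
  by apply: contraNN xS => mx; rewrite inE mx andbT -[appears _ _]in_set (mem_labels xb).
case/forallPn=> b0; rewrite negb_imply negb_or => /and3P[/andP[xb0 /forallP lx] _].
have [j nj jy] := next_label_leq (mem_labels yb') xy.
move/existsPn/(_ j); rewrite nj /= => /existsPn none.
have bj c : j \in T c -> before c b0.
  by move=> jc; have := none c; rewrite jc /= negb_and -ltnNge negbK.
have b0b : before b0 b.
  rewrite /before; have := lx b; rewrite xb /= leq_eqVlt => /orP[/eqP cb|-> //].
  by rewrite (column_distinctP _ cd _ _ _ cb xb0 xb) eqxx orbT.
have [ejy | njy] := eqVneq j y.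
  by apply: before_trans b0b; apply: bj; rewrite ejy.
have [/labelsP[c jc] xj _] := next_labelP nj.
apply: before_trans (before_trans (bj c jc) b0b).
have ltjy : j < y by rewrite ltn_neqAle njy.
apply: (IH j c) => //.
  by apply: leq_trans (ltn_sub2l xy xj) _.
apply/val_inj/anti_leq; rewrite up_leq ?(upS _ _ yb') //= -e.
by apply: up_leq (ltnW xj) (upS _ _ jc).
Qed.

End Relabelling.

(** * Mesonic glides in terms of rounding up *)

Section Glides.

Local Open Scope nat_scope.

Variables (n : nat) (w : 'X_{1..n}).
Implicit Types (b : 'X_{1..n}) (red : {set 'I_n}) (j k p q : 'I_n).

Definition msupport : {set 'I_n} := [set p | w p != 0].

Local Notation S := msupport.

(** Identifies the intervals in the definition of glides with the blocks of labels used for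
    fillings. *)
Lemma in_block p k : p \in S -> (k \in block w p) = (up S k == p).
Proof.
move=> pS; rewrite inE; apply/andP/eqP => [[kp /forallP lt] | <-].
  have [uS ku up_p] := up_min pS kp; apply/val_inj/anti_leq; rewrite up_p /= leqNgt.
  by apply/negP => ltp; have := lt (up S k); move: uS; rewrite inE ltp => ->; rewrite ltnNge ku.
split; first exact: leq_up.
apply/forallP => q; apply/implyP => /andP[qw qu]; rewrite ltnNge; apply/negP => kq.
have qS : q \in S by rewrite inE.
by have [_ _] := up_min qS kq; rewrite leqNgt qu.
Qed.

Lemma up_notinP k : reflect (forall q, w q != 0 -> q < k) (up S k \notin S).
Proof.
apply: (iffP idP) => [uN q qw | lt].
  rewrite ltnNge; apply: contra uN => kq.
  by have [] := @up_min n S k q _ kq; rewrite ?inE.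
by apply/negP; rewrite inE => /lt; rewrite ltnNge leq_up.
Qed.

(** Red entries are positive, so the subtraction is not truncated. *)
Lemma sum_sub_red b red (P : pred 'I_n) :
  komposition b red ->
  \sum_(k | P k) (b k - (k \in red)) + \sum_(k | P k) (k \in red) = \sum_(k | P k) b k.
Proof.
move=> /forall_inP kr; rewrite -big_split /=; apply: eq_bigr => k _.
by rewrite subnK //; case: (boolP (k \in red)) => // /kr; rewrite lt0n.
Qed.

(** The excess is absorbed into the sum, and blackness of the leftmost nonzero entry becomes a
    smaller nonzero entry in the block of each red one. *)
Lemma mesonic_glideP b red :
  reflect [/\ komposition b red,
              forall k, up S k \notin S -> b k = 0,
              forall p, p \in S -> \sum_(k | up S k == p) (b k - (k \in red)) = w p,
              forall k, k \in red -> up S k \in S ->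
                exists j, [/\ up S j = up S k, j < k & b j != 0]
            & forall p, p \in S -> b p != 0]
          (mesonic_glide w b red).
Proof.
have card_red p : p \in S -> #|block w p :&: red| = \sum_(k | up S k == p) (k \in red).
  move=> pS; rewrite -sum1_card big_mkcond [RHS]big_mkcond; apply: eq_bigr => k _.
  by rewrite inE in_block //; case: eqP => //= _; case: (k \in red).
have sumE b' p : p \in S -> \sum_(k in block w p) b' k = \sum_(k | up S k == p) b' k.
  by move=> pS; apply: eq_bigl => k; rewrite in_block.
apply: (iffP and3P) => [[kr /forallP gt /forallP gl] | [kr gt sm bl nz]]; split=> //.
- move=> k /up_notinP lt; apply/eqP/(implyP (gt k))/forallP => q.
  by apply/implyP => /lt.
- move=> p pS; have /implyP := gl p; rewrite -(in_set (fun p => w p != 0)) => /(_ pS) /and3P[/eqP e _ _].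
  move: e; rewrite card_red // sumE // -(sum_sub_red _ kr) => e.
  by apply/eqP; rewrite -(eqn_add2r (\sum_(k | up S k == p) (k \in red))) -e.
- move=> k kred uS; have /implyP := gl (up S k).
  rewrite -(in_set (fun p => w p != 0)) => /(_ uS) /and3P[_ /forall_inP bl _].
  have kb : k \in block w (up S k) by rewrite in_block.
  have := bl k kb; rewrite kred implybF negb_and (forall_inP kr) //=.
  move=> /forall_inPn[j jb]; rewrite negb_imply => /andP[jk bj].
  by exists j; split=> //; apply/eqP; rewrite -in_block.
- move=> p pS; have /implyP := gl p; rewrite -(in_set (fun p => w p != 0)).
  by move=> /(_ pS) /and3P[].
- apply/forallP => k; apply/implyP => /forallP lt; apply/eqP/gt/up_notinP => q.
  by move=> wq; have := lt q; rewrite wq.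
apply/forallP => p; apply/implyP => wp; have pS : p \in S by rewrite inE.
apply/and3P; split; last exact: nz.
  by rewrite card_red // sumE // -(sm p pS) sum_sub_red.
apply/forall_inP => k; rewrite in_block // => /eqP kp; apply/implyP => /andP[_ /forall_inP lo].
apply/negP => kred; have uS : up S k \in S by rewrite kp.
have [j [ej jk bj]] := bl k kred uS.
by have := lo j; rewrite in_block // ej kp eqxx jk (negPf bj) => /(_ isT).
Qed.

(** Adds up the length identities of all blocks; it makes the exponents of [beta] match. *)
Lemma mdeg_mesonic_glide b red : mesonic_glide w b red -> mdeg b = mdeg w + #|red|.
Proof.
case/mesonic_glideP => kr gt sm _ _.
rewrite !mdegE -(sum_sub_red xpredT kr); congr (_ + _); last first.
  rewrite -sum1_card [RHS]big_mkcond; apply: eq_bigr => k _.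
  by case: (k \in red).
rewrite (bigID (fun k => up S k \in S)) /= [X in _ + X]big1 ?addn0; last first.
  by move=> k /gt ->.
rewrite (partition_big (up S) (fun p => p \in S)) //= [RHS](bigID (fun p => p \in S)) /=.
rewrite [X in _ = _ + X]big1 ?addn0; last by move=> p; rewrite inE negbK => /eqP.
apply: eq_bigr => p pS; rewrite -(sm p pS); apply: eq_bigl => k.
by case: eqP => [->|]; rewrite ?pS ?andbF.
Qed.

End Glides.

(** * Splitting the occurrences of a label into intervals *)

Section Splitting.

Local Open Scope nat_scope.

Variables (n : nat) (a : 'X_{1..n}).
Implicit Types (T : filling a) (S : {set 'I_n}) (B C : box a).
Implicit Types (b : 'X_{1..n}) (red : {set 'I_n}) (i j k p : 'I_n).

Lemma wtE T i : wt T i = #|[set B | i \in T B]|.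
Proof. by rewrite mnmE. Qed.

Lemma wt_neq0 T i : (wt T i != 0) = (i \in labels T).
Proof.
rewrite wtE cards_eq0; apply/set0Pn/labelsP => -[B]; first by rewrite inE; exists B.
by move=> iB; exists B; rewrite inE.
Qed.

Lemma msupport_wt T : msupport (wt T) = labels T.
Proof. by apply/setP => i; rewrite inE wt_neq0. Qed.

Definition rank T p B := #|[set C | (p \in T C) && (col C < col B)]|.

Lemma rank_ltn T p B C : p \in T B -> col B < col C -> rank T p B < rank T p C.
Proof.
move=> pB BC; apply/proper_card/properP; split.
  by apply/subsetP => D; rewrite !inE => /andP[-> /ltn_trans->].
by exists B; rewrite !inE pB ?ltnn.
Qed.

Lemma rank_wt T p B : p \in T B -> rank T p B < wt T p.
Proof.
move=> pB; rewrite wtE; apply/proper_card/properP; split.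
  by apply/subsetP => D; rewrite !inE => /andP[->].
by exists B; rewrite !inE ?pB ?ltnn.
Qed.

Lemma rank_before T p B C :
  column_distinct T -> p \in T B -> p \in T C -> rank T p B <= rank T p C ->
  before B C.
Proof.
move=> /column_distinctP cd pB pC BC; rewrite /before; case: ltngtP => //= [CB | e].
  by have := rank_ltn pC CB; rewrite ltnNge BC.
by rewrite (cd _ _ _ e pB pC).
Qed.

(** The [wt T p] occurrences of [p] have distinct ranks below [wt T p], so the ranks are exactly
    [iota 0 (wt T p)]. *)
Lemma card_rank T p m m' :
  column_distinct T -> m <= m' <= wt T p ->
  #|[set B | (p \in T B) && (m <= rank T p B < m')]| = m' - m.
Proof.
move=> cd /andP[mm' m'w].
pose X := [set B | p \in T B].
have ranks : perm_eq (map (rank T p) (enum X)) (iota 0 (wt T p)).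
  have u : uniq (map (rank T p) (enum X)).
    rewrite map_inj_in_uniq ?enum_uniq // => B C; rewrite !mem_enum !inE => pB pC e.
    by apply: before_anti; [apply: (rank_before cd pB pC) | apply: (rank_before cd pC pB)]; rewrite e.
  have sub : {subset map (rank T p) (enum X) <= iota 0 (wt T p)}.
    by move=> r /mapP[B]; rewrite mem_enum inE mem_iota => pB -> /=; exact: rank_wt.
  apply: uniq_perm => //; first exact: iota_uniq.
  by case: (uniq_min_size u sub); rewrite // size_map size_iota -cardE wtE.
have -> : #|[set B | (p \in T B) && (m <= rank T p B < m')]|
        = count (fun r => m <= r < m') (map (rank T p) (enum X)).
  rewrite count_map -sum1_count big_enum_cond /= sum1dep_card.
  by apply: eq_card => B; rewrite !inE.
have wE : wt T p = m + ((m' - m) + (wt T p - m')) by rewrite addnA !subnKC.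
rewrite (permP ranks) wE !iotaD !count_cat add0n.
have -> : count (fun r => m <= r < m') (iota 0 m) = 0.
  apply/eqP; rewrite -leqn0 leqNgt -has_count; apply/hasPn => r.
  by rewrite mem_iota /= add0n ltnNge => /negPf ->.
rewrite subnKC // [X in _ + (_ + X)](_ : _ = 0); last first.
  apply/eqP; rewrite -leqn0 leqNgt -has_count; apply/hasPn => r.
  by rewrite mem_iota => /andP[m'r _]; rewrite [r < _]ltnNge m'r andbF.
rewrite add0n addn0 -[RHS](size_iota m); apply/eqP; rewrite -all_count.
by apply/allP => r; rewrite mem_iota subnKC.
Qed.

(* Among the occurrences of [up S k], numbered from 0 from left to right, the
   label [k] takes those with numbers [start k, .., start k + b k - 1]; a red
   label shares its last occurrence with the next smaller label. *)
Definition start S b red k :=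
  \sum_(j | (up S j == up S k) && (k < j)) (b j - (j \in red)).

Definition split_labels T b red : filling a :=
  [ffun B => [set k | (up (labels T) k \in T B) &&
     (start (labels T) b red k <= rank T (up (labels T) k) B
        < start (labels T) b red k + b k)]].

Definition reds S T :=
  [set k | [exists j, exists B, [&& up S j == up S k, j < k, j \in T B & k \in T B]]].

(** * From a chained filling to a mesonic glide *)

Section OfChained.

Variables (S : {set 'I_n}) (T : filling a).
Hypotheses (chT : chained S T) (cdT : column_distinct T).

Let chS B x : x \in T B -> up S x \in S.
Proof. by case: chT => h _ _; apply: h. Qed.

Let chB B C j k :
  j \in T B -> k \in T C -> up S j = up S k -> j < k -> before C B.
Proof. by case: chT => _ _; apply. Qed.

Local Notation U := (relabel S T).

(** Assigns each occurrence of [p] in the relabelled filling to a single label of [T], so that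
    shared boxes are counted once. The default [p] is irrelevant where [p] occurs. *)
Definition low p B := [arg min_(j < p | (j \in T B) && (up S j == p)) j].

Lemma lowP p B :
  p \in U B -> [/\ low p B \in T B, up S (low p B) = p
                 & forall i, i \in T B -> up S i = p -> low p B <= i].
Proof.
case/relabelP=> x xB e; have Px : (x \in T B) && (up S x == p) by rewrite xB e eqxx.
have [/andP[? /eqP ?] lmin] := @arg_min_default _ (fun j => (j \in T B) && (up S j == p)) p _ Px; split=> // i iB ip.
by apply: lmin; rewrite iB ip eqxx.
Qed.

(* The boxes containing [j] where it is not the least label of its block: none if [j] is not
   red, exactly one if it is, as two such boxes would each lie before the other. *)
Lemma card_low j :
  #|[set B | (up S j \in U B) && (low (up S j) B == j)]| = wt T j - (j \in reds S T).
Proof.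
set L := [set B | _]; rewrite wtE; set X := [set B | j \in T B].
have LX : L \subset X.
  by apply/subsetP => B; rewrite !inE => /andP[/lowP[lB _ _] /eqP e]; rewrite -{1}e.
rewrite -(cardsID L X) (setIidPr LX).
suff -> : #|X :\: L| = (j \in reds S T) by rewrite addnK.
have XLP B : B \in X :\: L -> exists i, [/\ i \in T B, up S i = up S j & i < j].
  rewrite !inE => /andP[nl jB]; have uB := mem_relabel S jB; rewrite uB /= in nl.
  have [lB ul lmin] := lowP uB; exists (low (up S j) B); split=> //.
  by rewrite ltn_neqAle nl lmin.
have [jr | jr] := boolP (j \in reds S T).
  have := jr; rewrite inE => /existsP[i /existsP[B /and4P[/eqP e ij iB jB]]].
  apply/eqP/cards1P; exists B; apply/setP => C; rewrite in_set1; apply/idP/eqP => [CX | ->].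
    have [i' [iC e' i'j]] := XLP C CX; have jC : j \in T C by move: CX; rewrite !inE => /andP[].
    by apply: before_anti; [exact: (chB iB jC) | exact: (chB iC jB)].
  rewrite !inE jB andbT negb_and; apply/orP; right.
  have [_ _ lmin] := lowP (mem_relabel S jB).
  by rewrite neq_ltn (leq_ltn_trans (lmin i iB e)).
apply/eqP; rewrite cards_eq0 -subset0; apply/subsetP => B BX; case/negP: jr.
have [i [iB e ij]] := XLP B BX; have jB : j \in T B by move: BX; rewrite !inE => /andP[].
by rewrite inE; apply/existsP; exists i; apply/existsP; exists B; rewrite e eqxx ij iB.
Qed.

Lemma sum_low p (P : pred 'I_n) :
  \sum_(j | (up S j == p) && P j) (wt T j - (j \in reds S T))
  = #|[set B | (p \in U B) && P (low p B)]|.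
Proof.
rewrite -sum1_card (partition_big (low p) (fun j => (up S j == p) && P j)) /=; last first.
  by move=> B; rewrite inE => /andP[/lowP[_ -> _] ->]; rewrite eqxx.
apply: eq_bigr => j /andP[/eqP e Pj]; rewrite -card_low sum1dep_card e.
apply: eq_card => B; rewrite !inE; case: (p \in U B) => //=.
by apply/eqP/andP => [-> | [_ /eqP]].
Qed.

Lemma start_low k :
  start S (wt T) (reds S T) k = #|[set B | (up S k \in U B) && (k < low (up S k) B)]|.
Proof. exact: (sum_low _ (fun j => k < j)). Qed.

(** Here [start] counts [L], the boxes of [p] whose least block label exceeds [k]; [wt T k] counts
    [X], the boxes of [k]; the rank counts [R], the boxes of [p] left of [B]. Chaining places [L]
    first, then [X], then the other boxes of [p]. *)
Lemma mem_interval B k :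
  (k \in T B) = (up S k \in U B) &&
     (start S (wt T) (reds S T) k <= rank U (up S k) B
        < start S (wt T) (reds S T) k + wt T k).
Proof.
have cdU : column_distinct U by rewrite (column_distinct_relabel chT).
rewrite start_low wtE /rank.
set p := up S k; set L := [set B | _ & _]; set R := [set C | _ & _]; set X := [set B | _].
have BR : B \notin R by rewrite inE ltnn andbF.
have low_before C D : p \in U C -> p \in U D -> low p C < low p D -> before D C.
  by move=> /lowP[lC uC _] /lowP[lD uD _]; apply: (chB lC lD); rewrite uC uD.
have before_R C : p \in U C -> before C B -> C != B -> C \in R.
  by move=> pC /orP[lt | ->] //; rewrite inE pC lt.
apply/idP/idP => [kB | ].
  have pB : p \in U B := mem_relabel S kB; rewrite pB /=; apply/andP; split.
    apply/subset_leq_card/subsetP => C; rewrite inE => /andP[pC kC].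
    have [lC uC _] := lowP pC; have [_ _ lmin] := lowP pB.
    apply: before_R => //; first exact: (chB kB lC).
    by apply: contraTneq kC => ->; rewrite -leqNgt lmin.
  apply: (@leq_trans #|L :|: X|); last by rewrite leq_card_setU.
  have -> : #|R|.+1 = #|B |: R| by rewrite cardsU1 BR.
  apply/subset_leq_card/subsetP => C; rewrite !inE.
  case/orP=> [/eqP-> | /andP[pC CB]]; first by rewrite kB orbT.
  rewrite pC /=; have [lC uC _] := lowP pC.
  case: ltngtP => //= [lk | /val_inj ->]; last by [].
  by have := before_col (chB lC kB uC lk); rewrite leqNgt CB.
apply: contraTT => kB; apply/negP => /andP[pB /andP[LR RLX]].
have [lB uB lmin] := lowP pB.
have nk : low p B != k by apply: contraNneq kB => <-.
(* When [B] does not contain [k], either [B] and [R] all fall into [L], or the disjoint sets [L] and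
   [X] both fall into [R]; each contradicts a cardinality bound. *)
have [kl | lk] := ltnP k (low p B).
  have: B |: R \subset L.
    apply/subsetP => C; rewrite in_setU1 => /orP[/eqP-> | ]; first by rewrite inE pB.
    rewrite !inE => /andP[pC CB]; rewrite pC /=; apply: leq_trans kl _.
    rewrite leqNgt; apply/negP => /(low_before _ _ pC pB) /before_col.
    by rewrite leqNgt CB.
  by move/subset_leq_card; rewrite cardsU1 BR add1n ltnNge LR.
have {}lk : low p B < k by rewrite ltn_neqAle nk.
have: L :|: X \subset R.
  apply/subsetP => C; rewrite in_setU => /orP[]; rewrite inE.
    case/andP=> pC kC; have lt := ltn_trans lk kC.
    by apply: before_R => //; [exact: low_before | apply: contraTneq lt => ->; rewrite ltnn].
  move=> kC; apply: before_R; [exact: mem_relabel | exact: (chB lB kC) |].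
  by apply: contraNneq kB => <-.
move/subset_leq_card; have/eqP -> : #|L :|: X| == #|L| + #|X|.
  rewrite (leq_card_setU L X).2; apply/pred0P => C /=; apply/negP; rewrite !inE.
  case/andP=> /andP[pC kC] kC'; have [_ _ lCmin] := lowP pC.
  by have := lCmin k kC' erefl; rewrite leqNgt kC.
by rewrite leqNgt RLX.
Qed.

Lemma split_labels_relabel : split_labels U (wt T) (reds S T) = T.
Proof.
apply/ffunP => B; rewrite ffunE; apply/setP => k.
by rewrite inE (labels_relabel chT) [RHS]mem_interval.
Qed.

Lemma mesonic_glide_relabel : mesonic_glide (wt U) (wt T) (reds S T).
Proof.
apply/mesonic_glideP; rewrite msupport_wt (labels_relabel chT); split.
- apply/forall_inP => k; rewrite inE => /existsP[j /existsP[B /and4P[_ _ _ kB]]].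
  by rewrite wt_neq0 (mem_labels kB).
- move=> k; apply: contraNeq; rewrite wt_neq0 => /labelsP[B]; exact: chS.
- move=> p _; have := sum_low p xpredT; rewrite wtE => h.
  transitivity #|[set B | (p \in U B) && true]|; last first.
    by apply: eq_card => B; rewrite !inE andbT.
  by rewrite -h; apply: eq_bigl => k; rewrite andbT.
- move=> k; rewrite inE => /existsP[j /existsP[B /and4P[/eqP e jk jB kB]]] _.
  by exists j; rewrite wt_neq0 (mem_labels jB).
- by move=> p pS; rewrite wt_neq0; case: chT => _ /subsetP/(_ p pS).
Qed.

End OfChained.

(** * From a mesonic glide to a chained filling *)

Section OfGlide.

Variables (U : filling a) (b : 'X_{1..n}) (red : {set 'I_n}).
Hypotheses (cdU : column_distinct U) (glide : mesonic_glide (wt U) b red).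

Local Notation S := (labels U).
Local Notation st := (start S b red).
Local Notation T := (split_labels U b red).

Let glideP :
  [/\ komposition b red,
      forall k, up S k \notin S -> b k = 0,
      forall p, p \in S -> \sum_(k | up S k == p) (b k - (k \in red)) = wt U p,
      forall k, k \in red -> up S k \in S ->
        exists j, [/\ up S j = up S k, j < k & b j != 0]
    & forall p, p \in S -> b p != 0].
Proof. by rewrite -msupport_wt; apply/mesonic_glideP. Qed.

Lemma mem_split B k : (k \in T B) = (up S k \in U B) && (st k <= rank U (up S k) B < st k + b k).
Proof. by rewrite ffunE inE. Qed.

Lemma red_neq0 k : k \in red -> b k != 0.
Proof. by case: glideP => /forall_inP kr _ _ _ _; apply: kr. Qed.

Lemma start_step j k :
  up S j = up S k -> j < k -> st k + (b k - (k \in red)) <= st j.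
Proof.
move=> e jk; rewrite /start (bigD1 (P := fun i => (up S i == up S j) && (j < i)) k) /=; last first.
  by rewrite e eqxx.
rewrite addnC leq_add2l; rewrite [leqRHS](bigID (fun i => k < i)) /= -[leqLHS]addn0.
apply: leq_add => //; apply/eq_leq/eq_bigl => i; rewrite e.
have [ki|] := ltnP k i; last by rewrite !andbF.
by rewrite !andbT (ltn_trans jk ki) neq_ltn ki orbT ?andbT.
Qed.

Lemma start_step_eq j k :
  up S j = up S k -> j < k ->
  (forall i, up S i = up S k -> j < i -> i < k -> b i = 0) ->
  st j = st k + (b k - (k \in red)).
Proof.
move=> e jk z; rewrite /start (bigD1 (P := fun i => (up S i == up S j) && (j < i)) k) /=; last first.
  by rewrite e eqxx.
rewrite addnC; congr (_ + _); rewrite [LHS](bigID (fun i => k < i)) /=.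
rewrite [X in _ + X]big1 ?addn0; last first.
  move=> i /andP[/andP[/andP[/eqP ei ji] ik] nki]; rewrite (z i) ?sub0n //; first by rewrite ei.
  by rewrite ltn_neqAle ik leqNgt.
apply: eq_bigl => i; rewrite e.
have [ki|] := ltnP k i; last by rewrite !andbF.
by rewrite !andbT (ltn_trans jk ki) neq_ltn ki orbT ?andbT.
Qed.

Lemma start_bound k : up S k \in S -> st k + (b k - (k \in red)) <= wt U (up S k).
Proof.
move=> uS; have [_ _ sm _ _] := glideP; rewrite -(sm _ uS).
rewrite (bigD1 (P := fun i => up S i == up S k) k) //= addnC leq_add2l.
rewrite [leqRHS](bigID (fun i => k < i)) /= -[leqLHS]addn0.
apply: leq_add => //; apply/eq_leq/eq_bigl => i.
have [ki|] := ltnP k i; last by rewrite !andbF.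
by rewrite !andbT neq_ltn ki orbT ?andbT.
Qed.

(** Only a red entry can reach past [st j], and then by a single box. *)
Lemma start_overlap j k : up S j = up S k -> j < k -> st k + b k <= (st j).+1.
Proof.
move=> e jk; apply: (@leq_trans (st k + (b k - (k \in red))).+1); last exact: start_step.
rewrite -addnS leq_add2l; case: (k \in red); last by rewrite subn0.
by rewrite subn1 leqSpred.
Qed.

(* The least nonzero entry of a block is black, so its interval ends exactly
   at [wt U (up S k)]. *)
Lemma start_end k : up S k \in S -> st k + b k <= wt U (up S k).
Proof.
move=> uS; have [kr | kb] := boolP (k \in red); last first.
  by have := start_bound uS; rewrite (negPf kb) subn0.
have [_ _ _ bl _] := glideP; have [j0 [e0 j0k bj0]] := bl k kr uS.
have P0 : (up S j0 == up S k) && (b j0 != 0) by rewrite e0 eqxx.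
have [j /andP[/eqP e bj] jmin] :=
  @arg_minnP _ j0 (fun j => (up S j == up S k) && (b j != 0)) val P0.
have jk : j < k := leq_ltn_trans (jmin j0 P0) j0k.
apply: leq_trans (start_overlap e jk) _.
have jS : up S j \in S by rewrite e.
have jr : j \notin red.
  apply/negP => jr; have [i [ei ij bi]] := bl j jr jS.
  by have := jmin i; rewrite ei e eqxx bi /= leqNgt ij => /(_ isT).
(* The possible overlap of one box is absorbed by [b j], which is positive. *)
have := start_bound jS; rewrite (negPf jr) subn0 e; apply: leq_trans.
by rewrite -addn1 leq_add2l lt0n.
Qed.

(** By [start_end] no interval runs past the last occurrence of [up S k], so [card_rank] counts its
    full length. *)
Lemma wt_split : wt T = b.
Proof.
apply/mnmP => k; rewrite wtE; have [uS | uS] := boolP (up S k \in S); last first.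
  have [_ -> // _ _ _] := glideP; apply/eqP; rewrite cards_eq0 -subset0.
  by apply/subsetP => B; rewrite inE mem_split => /andP[/mem_labels]; rewrite (negPf uS).
rewrite -[RHS](addKn (st k)) -(card_rank (p := up S k) cdU) ?leq_addr ?start_end //.
by apply: eq_card => B; rewrite !inE mem_split.
Qed.

(** Take the least [k] of the block that starts no later than [B]. If its interval ended before [B],
    the next smaller label of the block would also start by then; if there is none, the interval
    would exhaust all [wt U p] occurrences. *)
Lemma split_cover p B : p \in U B -> exists2 k, up S k = p & k \in T B.
Proof.
move=> pB; have pS := mem_labels pB; have [_ _ sm _ _] := glideP.
(* The label [p] is the largest of its block, so the sum is empty. *)
have st0 : st p = 0.
  rewrite /start big_pred0 // => j; rewrite (up_id pS).
  by apply/negbTE; rewrite negb_and -leqNgt; apply: contraTT (leq_up S j) => /norP[/negbNE/eqP-> ->].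
have Pp : (up S p == p) && (st p <= rank U p B) by rewrite (up_id pS) eqxx st0.
have [k /andP[/eqP kp sk] kmin] :=
  @arg_minnP _ p (fun k => (up S k == p) && (st k <= rank U p B)) val Pp.
exists k => //; rewrite mem_split kp pB sk /=.
rewrite ltnNge; apply/negP => big.
have {}big : st k + (b k - (k \in red)) <= rank U p B.
  by apply: leq_trans big; rewrite leq_add2l leq_subr.
have [j /andP[/eqP ej jk] | none] := pickP (fun j => (up S j == p) && (j < k)).
  have Pj : (up S j == p) && (j < k) by rewrite ej eqxx.
  have [i /andP[/eqP ei ik] imax] := @arg_maxnP _ j (fun j => (up S j == p) && (j < k)) val Pj.
  have := kmin i; rewrite ei eqxx (@start_step_eq i k) ?ei ?kp //; last first.
    move=> l el il lk; have := imax l; rewrite el eqxx lk => /(_ isT).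
    by rewrite /= leqNgt il.
  by rewrite big /= leqNgt ik => /(_ isT).
have := rank_wt pB; rewrite ltnNge -(sm p pS); apply/negP/negPn; apply: leq_trans big.
rewrite (bigD1 (P := fun i => up S i == p) k) ?kp //= addnC leq_add2r.
apply/eq_leq/eq_bigl => i; rewrite kp; have := none i; case: (up S i == p) => //=.
by rewrite -val_eqE /=; case: ltngtP.
Qed.

Lemma relabel_split : relabel S T = U.
Proof.
apply/ffunP => B; apply/setP => p; apply/relabelP/idP => [[k kB ->] | pB].
  by move: kB; rewrite mem_split => /andP[].
by have [k kp kB] := split_cover pB; exists k.
Qed.

(** An overlap is at most one box, so the ranks in the interval of [y] never exceed those in the
    interval of a smaller [x]; equal ranks mean the same box. *)
Lemma chained_split : chained S T.
Proof.
split.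
- by move=> B k; rewrite mem_split => /andP[/mem_labels].
- apply/subsetP => p pS; rewrite -wt_neq0 wt_split.
  by have [_ _ _ _] := glideP; apply.
move=> B C x y; rewrite !mem_split => /andP[xB /andP[sx _]] /andP[yC /andP[_ sy]] e xy.
rewrite -e in yC sy; apply: (rank_before cdU yC xB); apply: leq_trans sx.
by rewrite -ltnS; apply: leq_trans sy (start_overlap e xy).
Qed.

Lemma reds_split : reds S T = red.
Proof.
apply/setP => k; apply/idP/idP => [|kr].
  rewrite inE => /existsP[j /existsP[B /and4P[/eqP e jk]]].
  rewrite !mem_split e => /andP[_ /andP[sj _]] /andP[_ /andP[_ sk]].
  apply: contraLR sk => kb; rewrite -leqNgt; apply: leq_trans sj.
  by have := start_step e jk; rewrite (negPf kb) subn0.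
have bk := red_neq0 kr; have [_ gt _ bl _] := glideP.
have uS : up S k \in S by apply: contraNT bk => /gt ->.
have [j0 [e0 j0k bj0]] := bl k kr uS.
have P0 : [&& up S j0 == up S k, j0 < k & b j0 != 0] by rewrite e0 eqxx j0k.
(* The neighbour of [k]: zero entries between [j] and [k] do not shift the start, so [j] starts on
   the last box of the red label [k]. *)
have [j /and3P[/eqP e jk bj] jmax] :=
  @arg_maxnP _ j0 (fun j => [&& up S j == up S k, j < k & b j != 0]) val P0.
have sj : st j = st k + (b k - (k \in red)).
  apply: start_step_eq => // i ei ji ik; apply/eqP; apply: contraLR ji => bi.
  by rewrite -leqNgt; apply: jmax; rewrite ei eqxx ik.
have jS : up S j \in S by rewrite e.
have [B] : exists B, B \in [set B | (up S k \in U B) && (st j <= rank U (up S k) B < (st j).+1)].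
  apply/set0Pn; rewrite -card_gt0 (card_rank cdU) ?subSnn // leqnSn /=.
  rewrite -e; apply: leq_trans (start_end jS); by rewrite -addn1 leq_add2l lt0n.
rewrite inE ltnS => /andP[uB sB].
have {}sB : rank U (up S k) B = st j by apply/eqP; rewrite eqn_leq andbC.
rewrite inE; apply/existsP; exists j; apply/existsP; exists B.
rewrite e eqxx jk !mem_split e uB sB leqnn /= -[X in X < _]addn0 ltn_add2l lt0n bj /=.
by rewrite sj leq_addr ltn_add2l kr /= subn1 prednK ?leqnn // lt0n.
Qed.

End OfGlide.

End Splitting.

(** * Summation over the fibres of destandardization *)

Section Expansion.

Local Open Scope nat_scope.

Variables (n : nat) (a : 'X_{1..n}).
Implicit Types (T U : filling a).

Lemma mdeg_wt T : mdeg (wt T) = \sum_B #|T B|.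
Proof.
rewrite mdegE (eq_bigr (fun i => \sum_B (i \in T B))); last first.
  by move=> i _; rewrite wtE -sum1dep_card big_mkcond.
rewrite exchange_big /=; apply: eq_bigr => B _.
by rewrite -sum1_card [RHS]big_mkcond.
Qed.

Lemma card_box : #|{: box a}| = mdeg a.
Proof.
rewrite card_tagged sumnE big_map big_enum /= mdegE.
by apply: eq_bigr => i _; rewrite card_ord.
Qed.

Lemma leq_mdeg_wt T : set_valued T -> mdeg a <= mdeg (wt T).
Proof.
move=> /forallP sv; rewrite mdeg_wt -card_box -sum1_card.
by apply: leq_sum => B _; rewrite card_gt0.
Qed.

(** On semistandard fillings, the retraction onto the meson-highest ones. *)
Definition destandardize T := relabel (highs T) T.

Lemma destandardize_meson T :
  semistandard T -> semistandard (destandardize T) && meson_highest (destandardize T).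
Proof.
move=> ss; have ch := chained_highs ss; rewrite /destandardize.
rewrite (semistandard_relabel ch) ss (meson_highest_relabel ch) ?eqxx //.
by case/and5P: ss.
Qed.

(** Eliminates [highs T], which [meson_highest_relabel] forces to equal [labels U]. *)
Lemma destandardize_fiberP U T :
  semistandard U -> meson_highest U ->
  reflect (chained (labels U) T /\ relabel (labels U) T = U)
          (semistandard T && (destandardize T == U)).
Proof.
move=> ssU mhU; apply: (iffP andP) => [[ss /eqP e] | [ch e]].
  have ch := chained_highs ss.
  by rewrite -e /destandardize (labels_relabel ch).
have ss : semistandard T by rewrite -(semistandard_relabel ch) e.
split=> //; have sv : set_valued T by case/and5P: ss.
have := meson_highest_relabel ch sv; rewrite e mhU => /esym/eqP h.
by rewrite /destandardize h e.
Qed.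

Local Open Scope ring_scope.

Lemma sum_fiber U :
  semistandard U -> meson_highest U ->
  \sum_(T | semistandard T && (destandardize T == U))
     ('X ^+ ex T : {poly int}) *: 'X_[wt T]
  = ('X ^+ (mdeg (wt U) - mdeg a) : {poly int}) *: kaon (wt U).
Proof.
move=> ssU mhU; have cdU : column_distinct U by case/and5P: ssU.
have svU : set_valued U by case/and5P: ssU.
rewrite /kaon pair_big_dep /= scaler_sumr.
set D := (mdeg (wt U) + n).+1.
(* A default for packing weights into the bounded index type of [kaon]; by [mesonic_glide_mdeg] it
   is never reached on the fibre. *)
pose q0 : 'X_{1..n < D} := insubd bm0 (wt U).
pose h (q : 'X_{1..n < D} * {set 'I_n}) := split_labels U q.1 q.2.
pose h' T : 'X_{1..n < D} * {set 'I_n} := (insubd q0 (wt T), reds (labels U) T).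
have glideT T : chained (labels U) T -> relabel (labels U) T = U ->
    mesonic_glide (wt U) (wt T) (reds (labels U) T).
  by move=> ch e; have := mesonic_glide_relabel ch; rewrite e.
have h'1 T : mesonic_glide (wt U) (wt T) (reds (labels U) T) -> val (h' T).1 = wt T.
  by move=> gl; rewrite insubdK // unfold_in ltnS; exact: mesonic_glide_mdeg gl.
rewrite (reindex_onto h h') /=; last first.
  move=> T /(destandardize_fiberP _ ssU mhU)[ch e].
  have cdT : column_distinct T by rewrite -(column_distinct_relabel ch) e.
  rewrite /h h'1 ?glideT //.
  by have := split_labels_relabel ch cdT; rewrite e.
apply: eq_big => [q | q].
  apply/andP/idP => [[/(destandardize_fiberP _ ssU mhU)[ch e] /eqP hq] | gl].
    by have gl := glideT _ ch e; rewrite -hq /= h'1.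
  split.
    by apply/destandardize_fiberP; rewrite ?relabel_split //; split=> //; apply: chained_split.
  by rewrite /h' /h wt_split // reds_split // valKd; case: q gl.
case/andP=> /(destandardize_fiberP _ ssU mhU)[ch e] /eqP hq.
have gl := glideT _ ch e; have e1 := h'1 _ gl; rewrite hq in e1.
(* The excess of the filling is that of [U] plus the number of red entries. *)
rewrite scalerA -exprD /ex e1 (mdeg_mesonic_glide gl) addnBAC ?leq_mdeg_wt //.
by have /= <- := congr1 snd hq.
Qed.

Lemma lascoux_atom_kaon :
  lascoux_atom a = \sum_(U : filling a | semistandard U && meson_highest U)
    ('X ^+ (mdeg (wt U) - mdeg a) : {poly int}) *: kaon (wt U).
Proof.
rewrite /lascoux_atom
  (partition_big destandardize (fun U => semistandard U && meson_highest U)) /=; last first.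
  exact: destandardize_meson.
by apply: eq_bigr => U /andP[ssU mhU]; apply: sum_fiber.
Qed.

End Expansion.

Local Open Scope ring_scope.

Theorem theorem3p12 (n : nat) (hn : (0 < n)%N) :
  (forall a : 'X_{1..n},
     lascoux_atom a =
       \sum_(T : filling a | semistandard T && meson_highest T)
         ('X ^+ (mdeg (wt T) - mdeg a) : {poly int}) *: kaon (wt T)) /\
  (forall a : 'X_{1..n},
     exists (s : seq 'X_{1..n}) (c : 'X_{1..n} -> {poly int}),
       [/\ uniq s,
           forall (w : 'X_{1..n}) (k : nat), (0 : int) <= (c w)`_k
         & lascoux_atom a = \sum_(w <- s) c w *: kaon w]).
Proof.
split=> a; first exact: lascoux_atom_kaon.
pose P (T : filling a) := semistandard T && meson_highest T.
(* All weights of fillings are listed; one that no meson-highest filling has gets an empty sum as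
   coefficient. *)
pose s := undup [seq wt T | T : filling a].
exists s, (fun w => \sum_(T | P T && (wt T == w)) 'X ^+ (mdeg (wt T) - mdeg a)).
split=> [|w k|]; first exact: undup_uniq.
  rewrite coef_sum; apply: Num.Theory.sumr_ge0 => T _.
  by rewrite coefXn; case: (_ == _).
rewrite lascoux_atom_kaon; under [RHS]eq_bigr do rewrite scaler_suml.
rewrite (exchange_big_dep P) /=; last by move=> w T _ /andP[].
apply: eq_bigr => T PT.
rewrite (eq_bigl (fun w => w == wt T)); last by move=> w; rewrite /P PT eq_sym.
rewrite -big_filter filter_pred1_uniq ?undup_uniq ?big_seq1 //.
by rewrite mem_undup map_f // mem_enum.
Qed.
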